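(* The determining number of the augmented hypercube $AQ_n$ is $\det(AQ_n)=1$ if $n=1$; $3$ if $n=2$; $4$ if $n=3$; $3$ if $n\in\{4,5\}$; and $2$ if $n\ge 6$.
   Context: The augmented hypercube $AQ_n$ has vertex set $\mathbb{Z}_2^n$; two vertices $a=a_1\dots a_n$ and $b=b_1\dots b_n$ are adjacent iff either they differ in exactly one position, or for some $0\le \ell\le n-2$ they agree in the first $\ell$ positions and differ in all of the remaining $n-\ell$ positions. A determining set of a graph is a vertex set such that the only automorphism fixing each of its vertices is the identity; $\det$ is the minimum size of a determining set. *)

(* Defs.v *)
From HB Require Import structures.
From mathcomp Require Import all_boot all_order all_fingroup all_algebra.

Set Implicit Arguments.
Unset Strict Implicit.
Unset Printing Implicit Defensive.

Section Determining.

Variables (T : finType) (e : rel T).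

Definition graph_aut (f : {perm T}) : bool :=
  [forall x, forall y, e (f x) (f y) == e x y].

Definition determining (S : {set T}) : bool :=
  [forall f : {perm T},
     graph_aut f ==> [forall x in S, f x == x] ==> (f == 1%g)].

(* The minimum is over a nonempty family, by determiningT below. *)
Definition det_number : nat := #|[arg min_(S < setT | determining S) #|S|]|.

Lemma determiningT : determining setT.
Proof.
apply/forallP => f; apply/implyP => _; apply/implyP => /forall_inP fix_f.
by apply/eqP/permP => x; rewrite perm1; apply/eqP/fix_f; rewrite inE.
Qed.

End Determining.

(* Positions are numbered from 0, so "the first l positions" are those i with
   i < l; the bound l <= n - 2 is l : 'I_n.-1, empty for n <= 1. *)
Definition AQ (n : nat) : rel 'rV['F_2]_n := fun a b =>
  (#|[set i | a ord0 i != b ord0 i]| == 1) ||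
  [exists l : 'I_n.-1,
     [forall i : 'I_n, (i < l) ==> (a ord0 i == b ord0 i)] &&
     [forall i : 'I_n, (l <= i) ==> (a ord0 i != b ord0 i)]].

Lemma AQ_sym n : symmetric (@AQ n).
Proof.
move=> a b; rewrite /AQ; congr (_ || _).
  by congr (#|pred_of_set _| == 1); apply/setP => i; rewrite !inE eq_sym.
apply: eq_existsb => l; congr (_ && _);
  by apply: eq_forallb => i; rewrite eq_sym.
Qed.

Lemma AQ_irr n : irreflexive (@AQ n).
Proof.
move=> a; rewrite /AQ; apply/negP => /orP[/cards1P[i /setP/(_ i)]|].
  by rewrite !inE !eqxx.
case/existsP => l /andP[_ /forallP h].
have ltln : l < n by apply: leq_trans (ltn_ord l) (leq_pred n).
by have := h (Ordinal ltln); rewrite /= leqnn eqxx.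
Qed.

(* Main.v *)
(** In the basis of suffix indicators [s_i = e_i + ... + e_(n-1)], the graph
    [AQ n] becomes the Cayley graph of [F_2^n] whose generators are the unit
    vectors [u_i] and the sums [u_i + u_(i+1)]. Triangles of generators form the
    chain of lines [{u_i, u_(i+1), u_i + u_(i+1)}], and [u_1, ..., u_(n-2)] are
    exactly the generators lying on two lines. For [n >= 4] an automorphism
    therefore acts on these, around every vertex, as the identity or as the
    reversal of the chain; the choice is the same at all vertices, and comparing
    the two ways around 4-cycles shows that an automorphism fixing 0 is, up to
    reversal of the coordinates, one of the four maps
    [x |-> x + d x_0 u_1 + e x_(n-1) u_(n-2)]. So the stabiliser of 0 has order
    8, and some vertex is moved by all its nontrivial elements exactly when
    [n >= 6]. For [n <= 2] the graph is complete, and for [n = 3] its vertices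
    form four pairs of twins. *)

Require Import Defs.
From HB Require Import structures.
From mathcomp Require Import all_boot all_order all_fingroup all_algebra.
From mathcomp Require Import zify.

Set Implicit Arguments.
Unset Strict Implicit.
Unset Printing Implicit Defensive.

Import GRing.Theory.
Local Open Scope ring_scope.

(** * Determining sets of arbitrary finite graphs *)

(** Plain injective functions replace permutations, so that maps given by formulas or compositions
    can be used directly. *)
Lemma determiningP (T : finType) (e : rel T) (S : {set T}) :
  reflect (forall f : T -> T, injective f ->
             (forall x y, e (f x) (f y) = e x y) ->
             {in S, f =1 id} -> f =1 id)
          (determining e S).
Proof.
apply: (iffP forallP) => [detS f f_inj f_e f_S x | detS f].
  have := detS (perm f_inj); rewrite /graph_aut.
  have -> : [forall x, forall y, e (perm f_inj x) (perm f_inj y) == e x y].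
    by apply/forallP => y; apply/forallP => z; rewrite !permE f_e.
  have -> /= : [forall x in S, perm f_inj x == x].
    by apply/forall_inP => y /f_S; rewrite permE => ->.
  by move/eqP/permP/(_ x); rewrite permE perm1.
apply/implyP => /forallP f_e; apply/implyP => /forall_inP f_S.
apply/eqP/permP => x; rewrite perm1; apply: detS => {x} [|x y|x /f_S/eqP//].
  exact: perm_inj.
by apply/eqP; have /forallP := f_e x; apply.
Qed.

Lemma det_number_eq (T : finType) (e : rel T) k (S : {set T}) :
  determining e S -> (#|S| <= k)%N ->
  (forall S', determining e S' -> (k <= #|S'|)%N) ->
  det_number e = k.
Proof.
rewrite /det_number => detS leSk lbk.
case: arg_minnP => [|S' detS' minS']; first exact: determiningT.
by apply/eqP; rewrite eqn_leq lbk // (leq_trans (minS' _ detS)).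
Qed.

Lemma determining_imset (T U : finType) (e : rel T) (e' : rel U)
    (p : T -> U) S :
  bijective p -> (forall x y, e x y = e' (p x) (p y)) ->
  determining e S -> determining e' (p @: S).
Proof.
move=> [q pK qK] e_e' /determiningP detS.
apply/determiningP => f f_inj f_e f_S x.
rewrite -[RHS]qK -[f x]qK -{1}(qK x); congr p.
apply: (detS (q \o f \o p)) => [|y z|y yS] /=.
- by apply: inj_comp (can_inj pK); apply: inj_comp f_inj; apply: can_inj qK.
- by rewrite !e_e' !qK f_e.
- by rewrite f_S ?pK ?imset_f.
Qed.

Lemma det_number_iso (T U : finType) (e : rel T) (e' : rel U) (p : T -> U) :
  bijective p -> (forall x y, e x y = e' (p x) (p y)) ->
  det_number e = det_number e'.
Proof.
move=> p_bij e_e'; rewrite [RHS]/det_number.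
case: arg_minnP => [|S' detS' minS']; first exact: determiningT.
have [q pK qK] := p_bij; have q_bij : bijective q by exists p.
apply: (@det_number_eq _ _ _ (q @: S')).
- by apply: determining_imset detS' => // x y; rewrite e_e' !qK.
- exact: leq_imset_card.
move=> S /(determining_imset p_bij e_e')/minS' /leq_trans; apply.
exact: leq_imset_card.
Qed.

(** Transposing the twins [x] and [y] is an automorphism, and it fixes [S] pointwise when [S] avoids
    both. *)
Lemma determining_twins (T : finType) (e : rel T) S x y :
  symmetric e -> irreflexive e -> x != y ->
  (forall z, z != x -> z != y -> e z x = e z y) ->
  determining e S -> (x \in S) || (y \in S).
Proof.
move=> e_sym e_irr xy e_xy /determiningP detS; apply: contraT; rewrite negb_or.
case/andP=> xS yS; suff eq_yx : y = x by rewrite eq_yx eqxx in xy.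
rewrite -{1}(tpermL x y); apply: detS; first exact: perm_inj.
  move=> z t; case: tpermP => [->|->|/eqP zx /eqP zy];
    case: tpermP => [->|->|/eqP tx /eqP ty]; rewrite ?e_irr //.
  - by rewrite [LHS]e_sym [RHS]e_sym e_xy.
  - by rewrite [LHS]e_sym [RHS]e_sym e_xy.
  - by rewrite e_xy.
  - by rewrite e_xy.
by move=> z zS; rewrite tpermD //; apply: contraTneq zS => <-.
Qed.

Lemma det_number_complete (T : finType) (e : rel T) (x0 : T) :
  (forall x y, e x y = (x != y)) -> det_number e = #|T|.-1.
Proof.
move=> eE; apply: (@det_number_eq _ _ _ [set~ x0]).
- apply/determiningP => f f_inj _ f_S x.
  have [->|x_x0] := eqVneq x x0; last by rewrite f_S // !inE.
  apply/eqP; apply: contraT => f_x0.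
  have fx0S : f x0 \in [set~ x0] by rewrite !inE.
  by rewrite (f_inj _ _ (f_S _ fx0S)) eqxx in f_x0.
- by rewrite cardsC1.
(* Any two vertices are twins here, so at most one lies outside [S]. *)
move=> S detS; rewrite -(cardsC S) -subn1 leq_subLR addnC leq_add2r.
rewrite leqNgt; apply/negP => /card_gt1P[x [y [xS yS xy]]].
have := determining_twins (x := x) (y := y) _ _ xy _ detS.
rewrite !inE in xS yS; rewrite (negPf xS) (negPf yS) => H; apply/notF/H.
- by move=> z t; rewrite !eE eq_sym.
- by move=> z; rewrite eE eqxx.
- by move=> z zx zy; rewrite !eE zx zy.
Qed.

(** * Vectors over ['F_2] as bit sequences *)

Section Vectors.

Variable n : nat.
Implicit Types v w x y : 'rV['F_2]_n.

(** Indexed by all naturals, with [false] past the end, so that index arithmetic needs no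
    ordinals. *)
Definition bit v (k : nat) : bool :=
  if insub k is Some i then v ord0 i != 0 else false.

Definition row_of (F : nat -> bool) : 'rV['F_2]_n := \row_i (F i)%:R.

Definition unit_row (k : nat) := row_of (eq_op^~ k).

Local Notation u := unit_row.

Lemma bit_ord v (i : 'I_n) : bit v i = (v ord0 i != 0).
Proof. by rewrite /bit valK. Qed.

Lemma bit_ge v k : (n <= k)%N -> bit v k = false.
Proof. by move=> nk; rewrite /bit insubN // -leqNgt. Qed.

Lemma eqF2 (a b : 'F_2) : (a != 0) = (b != 0) -> a = b.
Proof.
case: a b => [[|[|a]] ha] [[|[|b]] hb] // _; exact/val_inj.
Qed.

Lemma bitP v w : (forall k, (k < n)%N -> bit v k = bit w k) -> v = w.
Proof. by move=> vw; apply/rowP => i; apply: eqF2; rewrite -!bit_ord vw. Qed.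

Lemma bitD v w k : bit (v + w) k = bit v k (+) bit w k.
Proof.
have [nk|kn] := leqP n k; first by rewrite !bit_ge.
rewrite !(bit_ord _ (Ordinal kn)) mxE.
move: (v _ _) (w _ _) => a b.
by case: a b => [[|[|a]] ha] [[|[|b]] hb].
Qed.

Lemma bit0 k : bit 0 k = false.
Proof.
have [nk|kn] := leqP n k; first by rewrite bit_ge.
by rewrite (bit_ord _ (Ordinal kn)) mxE eqxx.
Qed.

Lemma bitMn v (b : bool) k : bit (v *+ b) k = b && bit v k.
Proof. by case: b; rewrite ?mulr1n ?mulr0n ?bit0. Qed.

Lemma bit_row F k : bit (row_of F) k = (k < n)%N && F k.
Proof.
have [nk|kn] := leqP n k; first by rewrite bit_ge.
by rewrite (bit_ord _ (Ordinal kn)) mxE; case: (F _).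
Qed.

Lemma bit_u i k : bit (u i) k = (k < n)%N && (k == i).
Proof. exact: bit_row. Qed.

End Vectors.

Ltac bits :=
  apply: bitP => ? ?; rewrite ?bitD ?bit0; by repeat case: (bit _ _).

(** * The generators and the chain of lines they form *)

Section Generators.

Variable n : nat.
Implicit Types g h v w x y : 'rV['F_2]_n.

Local Notation u := (unit_row n).

Lemma addxx v : v + v = 0.
Proof. by bits. Qed.

Lemma addxK v w : v + (v + w) = w.
Proof. by bits. Qed.

Lemma addx_eq0 v w : (v + w == 0) = (v == w).
Proof.
apply/eqP/eqP => [vw|->]; last exact: addxx.
by rewrite -[RHS](addxK v) vw addr0.
Qed.

Lemma addx2 x v w : (x + v) + (x + w) = v + w.
Proof. by bits. Qed.

Lemma bit_eq k v w : v = w -> bit v k = bit w k.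
Proof. by move->. Qed.

Lemma u_inj i j : (i < n)%N -> u i = u j -> i = j.
Proof. by move=> i_n /(bit_eq i); rewrite !bit_u; lia. Qed.

Definition gen v : bool :=
  [exists i : 'I_n, (v == u i) || ((i.+1 < n)%N && (v == u i + u i.+1))].

Lemma genP v :
  reflect ((exists2 i, (i < n)%N & v = u i) \/
           (exists2 i, (i.+1 < n)%N & v = u i + u i.+1)) (gen v).
Proof.
apply: (iffP existsP) => [[i /orP[/eqP->|/andP[i_n /eqP->]]]|].
- by left; exists i.
- by right; exists i.
case=> [[i i_n ->]|[i i_n ->]]; first by exists (Ordinal i_n); rewrite eqxx.
by exists (Ordinal (ltnW i_n)); rewrite /= i_n eqxx orbT.
Qed.

Lemma gen_u i : (i < n)%N -> gen (u i).
Proof. by move=> i_n; apply/genP; left; exists i. Qed.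

Lemma gen_uuS i : (i.+1 < n)%N -> gen (u i + u i.+1).
Proof. by move=> i_n; apply/genP; right; exists i. Qed.

Lemma gen_uSu i : (i.+1 < n)%N -> gen (u i.+1 + u i).
Proof. by rewrite addrC; apply: gen_uuS. Qed.

(** The support of a generator fits in two consecutive positions; this is the test that rejects sums
    that are too wide. *)
Lemma gen_diam v i j : gen v -> bit v i -> bit v j -> (i <= j.+1)%N.
Proof. by case/genP=> -[k k_n ->]; rewrite ?bitD !bit_u; lia. Qed.

Lemma genF0 : gen 0 = false.
Proof.
by apply/negbTE/negP => /genP[[i i_n]|[i i_n]] /(bit_eq i);
  rewrite bit0 ?bitD !bit_u; lia.
Qed.

Lemma gen_addu i j : (i < n)%N -> (j < n)%N -> gen (u i + u j) ->
  i = j.+1 \/ j = i.+1.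
Proof.
move=> i_n j_n gij; have i_j : i != j.
  by apply: contraTneq gij => ->; rewrite addxx genF0.
have := gen_diam (i := i) (j := j) gij; have := gen_diam (i := j) (j := i) gij.
rewrite !bitD !bit_u; lia.
Qed.

Definition on_line i v := [\/ v = u i, v = u i.+1 | v = u i + u i.+1].

(** Distinct generators on no common line have a sum whose support is too wide for [gen_diam]. *)
Lemma gen_line g h : gen g -> gen h -> gen (g + h) ->
  exists i, [/\ (i.+1 < n)%N, on_line i g & on_line i h].
Proof.
have mixed i j : (i < n)%N -> (j.+1 < n)%N -> gen (u i + (u j + u j.+1)) ->
    on_line j (u i).
  move=> i_n j_n gij; case: (ltngtP i j) => [ij|ij|->]; last by constructor 1.
    have := gen_diam (i := j.+1) (j := i) gij; rewrite !bitD !bit_u; lia.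
  have [->|ij1] := eqVneq i j.+1; first by constructor 2.
  have := gen_diam (i := i) (j := j) gij; rewrite !bitD !bit_u; lia.
case/genP=> [[i i_n ->]|[i i_n ->]] /genP[[j j_n ->]|[j j_n ->]] gij.
- have [ij|ij] := gen_addu i_n j_n gij; subst.
    by exists j; split=> //; [constructor 2 | constructor 1].
  by exists i; split=> //; [constructor 1 | constructor 2].
- by exists j; split=> //; [apply: mixed | constructor 3].
- by exists i; split=> //; [constructor 3 | apply: mixed; rewrite // addrC].
case: (ltngtP i j) => [ij|ij|ij]; last by rewrite ij addxx genF0 in gij.
  have := gen_diam (i := j.+1) (j := i) gij; rewrite !bitD !bit_u; lia.
have := gen_diam (i := i.+1) (j := j) gij; rewrite !bitD !bit_u; lia.
Qed.

Lemma on_line_add i g h v : on_line i g -> on_line i h -> on_line i v ->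
  g != h -> g != v -> h != v -> h + v = g.
Proof.
by case=> -> [] -> [] ->; rewrite ?eqxx // => _ _ _; bits.
Qed.

(** A criterion for inner unit vectors that mentions only [gen], so automorphisms transport it: [g]
    lies on a line with [h] and on another with [v], and two distinct lines can meet only in an
    inner [u i]. *)
Lemma gen_inner g h v : gen g -> gen h -> gen v -> gen (g + h) -> gen (g + v) ->
  h != v -> ~~ gen (h + v) -> exists2 i, (0 < i < n.-1)%N & g = u i.
Proof.
move=> gg gh gv ggh ggv hv hv_n.
have [i [i_n ig ih]] := gen_line gg gh ggh.
have [j [j_n jg jv]] := gen_line gg gv ggv.
have neq w : gen (g + w) -> g != w.
  by apply: contraTneq => ->; rewrite addxx genF0.
(* On a common line, [h + v] would be the third point [g], which is a generator. *)
have ij : i != j.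
  apply: contraNneq hv_n => ij; subst j.
  by rewrite (on_line_add ig ih jv) // neq.
have [i1 j1] := (ltnW i_n, ltnW j_n).
(* Lines with a common point are consecutive; the four bits at their ends decide which comes
   first. *)
have diff : (i = j.+1 /\ g = u i) \/ (j = i.+1 /\ g = u j).
  case: ig jg => -> [] E; rewrite -?E; have := bit_eq i E; have := bit_eq j E;
   have := bit_eq i.+1 E; have := bit_eq j.+1 E; rewrite ?bitD !bit_u;
   try (by left; split; [lia|]); try (by right; split; [lia|]); lia.
by case: diff => -[e ->]; [exists i | exists j]; rewrite // e; lia.
Qed.

(** Induction on [m] over the truncations of [x] to its first [m] coordinates. *)
Lemma vec_ind (P : 'rV['F_2]_n -> Prop) :
  P 0 -> (forall x i, (i < n)%N -> P x -> P (x + u i)) -> forall x, P x.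
Proof.
move=> P0 PD x.
suff IH m : (m <= n)%N -> P (row_of n (fun i => (i < m)%N && bit x i)).
  have := IH n (leqnn n); congr P; apply: bitP => k kn.
  by rewrite bit_row kn.
elim: m => [_|m IH m_n].
  by congr P: P0; apply: bitP => k kn; rewrite bit_row bit0 andbF.
have Pm := IH (ltnW m_n).
case xm: (bit x m); last first.
  congr P: Pm; apply: bitP => k kn; rewrite !bit_row.
  by case: (ltngtP k m) => [||->]; rewrite ?xm; lia.
have := PD _ _ m_n Pm; congr P; apply: bitP => k kn.
rewrite bitD bit_u !bit_row.
by case: (ltngtP k m) => [||->]; rewrite ?xm; lia.
Qed.

Definition rev_row x : 'rV['F_2]_n := \row_i x ord0 (rev_ord i).

Lemma bit_rev x k : bit (rev_row x) k = (k < n)%N && bit x (n - k.+1).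
Proof.
have [nk|kn] := leqP n k; first by rewrite bit_ge.
by rewrite (bit_ord _ (Ordinal kn)) mxE -bit_ord.
Qed.

Lemma rev_rowK : involutive rev_row.
Proof.
move=> x; apply: bitP => k kn; rewrite !bit_rev kn /=.
have -> : (n - k.+1 < n)%N by lia.
by congr bit; lia.
Qed.

Lemma rev_rowD x y : rev_row (x + y) = rev_row x + rev_row y.
Proof. by apply/rowP => i; rewrite !mxE. Qed.

Lemma rev_row0 : rev_row 0 = 0.
Proof. by apply/rowP => i; rewrite !mxE. Qed.

Lemma rev_u i : (i < n)%N -> rev_row (u i) = u (n - i.+1).
Proof. by move=> i_n; apply: bitP => k kn; rewrite bit_rev !bit_u; lia. Qed.

Lemma gen_rev x : gen (rev_row x) = gen x.
Proof.
suff imp y : gen y -> gen (rev_row y).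
  by apply/idP/idP => /imp //; rewrite rev_rowK.
case/genP=> -[i i_n ->]; rewrite ?rev_rowD !rev_u ?gen_u //; try lia.
by have -> : (n - i.+1 = (n - i.+2).+1)%N by [lia]; apply: gen_uSu; lia.
Qed.

End Generators.

(** * Local action of an automorphism on the inner generators *)

(** Injectivity forbids turning back, so the first step fixes the direction of the whole walk on the
    path [1, ..., m - 1]; the range then leaves no room for a shift. *)
Lemma path_walk m (p : nat -> nat) : (2 < m)%N ->
  (forall i, 0 < i < m -> 0 < p i < m)%N ->
  (forall i j, (0 < i < m)%N -> (0 < j < m)%N -> p i = p j -> i = j) ->
  (forall i, (0 < i)%N -> (i.+1 < m)%N ->
     p i = (p i.+1).+1 \/ p i.+1 = (p i).+1) ->
  (forall i, (0 < i < m)%N -> p i = i) \/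
  (forall i, (0 < i < m)%N -> p i = (m - i)%N).
Proof.
move=> m_gt2 p_in p_inj p_step.
have p1 : (0 < p 1 < m)%N by apply: p_in; lia.
(* [m.-2.+1] is the last index [m - 1], in the successor form used by [p_sum]. *)
have pm : (0 < p m.-2.+1 < m)%N by apply: p_in; lia.
case: (p_step 1%N) => // p2.
  have p_dn i : (i.+2 < m)%N -> p i.+1 = (p i.+2).+1.
    elim: i => // i IH i_m.
    have {}IH := IH (ltnW i_m); have [//|//|//|p3] := p_step i.+2.
    have ne : p i.+1 <> p i.+3 by move/p_inj; lia.
    by case: ne; rewrite IH p3.
  have p_sum i : (i.+1 < m)%N -> p 1%N = (p i.+1 + i)%N.
    elim: i => [|i IH i_m]; first by rewrite addn0.
    by rewrite (IH (ltnW i_m)) p_dn // addSnnS.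
  right=> -[//|i] /andP[_ i_m]; have pi := p_sum i i_m.
  have pl : p 1%N = (p m.-2.+1 + m.-2)%N by apply: p_sum; lia.
  by clear - m_gt2 p1 pm i_m pi pl; lia.
have p_up i : (i.+2 < m)%N -> p i.+2 = (p i.+1).+1.
  elim: i => // i IH i_m.
  have {}IH := IH (ltnW i_m); have [//|//|p3|//] := p_step i.+2.
  have ne : p i.+1 <> p i.+3 by move/p_inj; lia.
  by case: ne; apply: succn_inj; rewrite -IH -p3.
have p_sum i : (i.+1 < m)%N -> p i.+1 = (p 1 + i)%N.
  elim: i => [|i IH i_m]; first by rewrite addn0.
  by rewrite p_up // (IH (ltnW i_m)) addnS.
left=> -[//|i] /andP[_ i_m]; have pi := p_sum i i_m.
have pl : p m.-2.+1 = (p 1%N + m.-2)%N by apply: p_sum; lia.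
by clear - m_gt2 p1 pm i_m pi pl; lia.
Qed.

Section LocalAction.

Variable n : nat.
Hypothesis n_ge4 : (3 < n)%N.
Implicit Types x y : 'rV['F_2]_n.

Local Notation u := (unit_row n).

(** The two conjuncts are the automorphism premises of [determiningP] for the Cayley graph. *)
Definition gen_aut (f : 'rV['F_2]_n -> 'rV['F_2]_n) :=
  injective f /\ forall x y, gen (f x + f y) = gen (x + y).

Definition id_at f x := forall i, (0 < i < n.-1)%N -> f (x + u i) = f x + u i.

Definition rev_at f x :=
  forall i, (0 < i < n.-1)%N -> f (x + u i) = f x + u (n - i.+1).

Section OneAutomorphism.

Variable f : 'rV['F_2]_n -> 'rV['F_2]_n.
Hypothesis f_aut : gen_aut f.

Lemma gen_aut_edge x v w : gen (f (x + v) + f (x + w)) = gen (v + w).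
Proof. by rewrite f_aut.2 addx2. Qed.

Lemma gen_aut_edge0 x v : gen (f x + f (x + v)) = gen v.
Proof. by rewrite f_aut.2 addxK. Qed.

(** The differences [d v] turn triangles at [x] into triangles at [f x], so [gen_inner] applies to
    the image of an inner unit vector and of its two neighbours in the chain. *)
Lemma gen_aut_inner x i : (0 < i < n.-1)%N ->
  exists2 j, (0 < j < n.-1)%N & f (x + u i) = f x + u j.
Proof.
case: i => // i /andP[_ i_n].
pose d v := f x + f (x + v).
have gd v : gen (d v) = gen v by rewrite gen_aut_edge0.
have gdd v w : gen (d v + d w) = gen (v + w) by rewrite addx2 gen_aut_edge.
have [] := @gen_inner n (d (u i.+1)) (d (u i)) (d (u i.+2)).
- by rewrite gd gen_u //; lia.
- by rewrite gd gen_u //; lia.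
- by rewrite gd gen_u //; lia.
- by rewrite gdd gen_uSu //; lia.
- by rewrite gdd gen_uuS //; lia.
- apply/eqP => /addrI/f_aut.1/addrI/u_inj; lia.
- by rewrite gdd; apply/negP => /gen_addu; lia.
by move=> j j_n dj; exists j => //; rewrite -dj addxK.
Qed.

(** Indices are consecutive exactly when the sum of their unit vectors is a generator, so the
    induced index map [p] is a walk as in [path_walk]. *)
Lemma gen_aut_id_or_rev x : id_at f x \/ rev_at f x.
Proof.
(* The boolean implication makes the existence claim hold for every [i], so that [sigW] can extract
   a function. *)
have /(_ _)/sigW ex_p i : exists j, (0 < i < n.-1)%N ==>
    ((0 < j < n.-1)%N && (f (x + u i) == f x + u j)).
  case i_in: (0 < i < n.-1)%N; last by exists 0%N.
  by have [j j_in ->] := gen_aut_inner x i_in; exists j; rewrite /= j_in eqxx.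
pose p i := sval (ex_p i).
have p_in i : (0 < i < n.-1)%N -> (0 < p i < n.-1)%N.
  by move=> i_in; case/andP: (implyP (svalP (ex_p i)) i_in).
have fE i : (0 < i < n.-1)%N -> f (x + u i) = f x + u (p i).
  by move=> i_in; case/andP: (implyP (svalP (ex_p i)) i_in) => _ /eqP.
clearbody p => {ex_p}.
have [||||pE|pE] := @path_walk n.-1 p; first lia.
- exact: p_in.
- move=> i j i_in j_in pij; have := fE i i_in; rewrite pij -fE //.
  by move/f_aut.1/addrI/u_inj; lia.
- move=> i i_gt0 i_n.
  have [i_in i1_in] : (0 < i < n.-1)%N /\ (0 < i.+1 < n.-1)%N by lia.
  have := p_in _ i_in; have := p_in _ i1_in => pi1_in pi_in.
  apply: (@gen_addu n); [lia | lia |].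
  rewrite -(addx2 (f x)) -!fE // gen_aut_edge gen_uuS //; lia.
- by left=> i i_in; rewrite fE // pE.
by right=> i i_in; rewrite fE // pE //; congr (_ + u _); lia.
Qed.

(** Identity and reversal agree only at the midpoint of the chain, so one fixed generator off the
    midpoint decides between them. *)
Lemma id_at_fix x i : (0 < i < n.-1)%N -> i.*2 != n.-1 ->
  f (x + u i) = f x + u i -> id_at f x.
Proof.
move=> i_in i_c fxi; case: (gen_aut_id_or_rev x) => // /(_ i i_in).
by rewrite fxi => /addrI/u_inj; lia.
Qed.

(** Since [i] may be the midpoint, index 1 serves as the witness: walking back along [u 1] settles
    [x + u 1], and the 4-cycle in directions [u 1] and [u i] then settles [x + u i]. *)
Lemma id_at_addu_inner x i : id_at f x -> (0 < i < n.-1)%N -> id_at f (x + u i).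
Proof.
move=> idx i_in; have in1 : (0 < 1 < n.-1)%N by lia.
have id1 : id_at f (x + u 1).
  apply: (id_at_fix in1); first lia.
  by rewrite (idx _ in1) -!addrA !addxx !addr0.
apply: (id_at_fix in1); first lia.
by rewrite addrAC id1 // !idx // addrAC.
Qed.

(** The image [h] of the direction [u 0] shares a line with [u 1], but [h + u 2] is no generator. Of
    the points on the first two lines, only [u 0] and [u 0 + u 1] survive. *)
Lemma id_at_first x : id_at f x -> exists d : bool,
  f (x + u 0) = f x + (u 0 + u 1 *+ d).
Proof.
move=> idx; have [in1 in2] : (0 < 1 < n.-1 /\ 0 < 2 < n.-1)%N by lia.
pose h := f x + f (x + u 0).
have fE : f (x + u 0) = f x + h by rewrite /h addxK.
have gh : gen h by rewrite gen_aut_edge0 gen_u //; lia.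
have gh1 : gen (h + u 1).
  by rewrite -(addx2 (f x)) -fE -idx // gen_aut_edge gen_uuS //; lia.
have gh2 : ~~ gen (h + u 2).
  rewrite -(addx2 (f x)) -fE -idx // gen_aut_edge.
  by apply/negP => /gen_addu; lia.
have [h1 h2] : h != u 1 /\ h != u 2.
  by split; apply/eqP => hE; move: fE; rewrite hE -idx //;
     move/f_aut.1/addrI/u_inj; lia.
have g1 : gen (u 1) by apply: gen_u; lia.
have [i [i_n ih i1]] := gen_line gh g1 gh1.
have i01 : i = 0%N \/ i = 1%N.
  case: i1 => /(bit_eq 1%N); rewrite ?bitD !bit_u; lia.
case: i01 => iE; subst i; case: ih => hE.
- by exists false; rewrite fE hE mulr0n addr0.
- by rewrite hE eqxx in h1.
- by exists true; rewrite fE hE mulr1n.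
- by rewrite hE eqxx in h1.
- by rewrite hE eqxx in h2.
by rewrite hE -addrA addxx addr0 g1 in gh2.
Qed.

(** If [f] reversed the chain at [x + u 0], the two ways around the 4-cycle in directions [u 0] and
    [u 1] would differ at coordinate [n - 2], which is at least 2. *)
Lemma id_at_addu0 x : id_at f x -> id_at f (x + u 0).
Proof.
move=> idx; have in1 : (0 < 1 < n.-1)%N by lia.
have [d fE] := id_at_first idx.
have [d' fE'] := id_at_first (id_at_addu_inner idx in1).
case: (gen_aut_id_or_rev (x + u 0)) => // /(_ 1%N in1).
rewrite addrAC fE' fE idx // => /(bit_eq (n - 2)%N).
rewrite !bitD !bitMn !bit_u; lia.
Qed.

End OneAutomorphism.

End LocalAction.

(** * The stabiliser of 0 for [n >= 4] *)

Section Automorphisms.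

Variable n : nat.
Hypothesis n_ge4 : (3 < n)%N.
Implicit Types x y : 'rV['F_2]_n.

Local Notation u := (unit_row n).

Lemma gen_aut_comp f g : @gen_aut n f -> gen_aut g -> gen_aut (f \o g).
Proof.
move=> [f_inj fE] [g_inj gE]; split=> [|x y]; first exact: inj_comp.
by rewrite /= fE gE.
Qed.

Lemma gen_aut_rev : gen_aut (@rev_row n).
Proof.
split; first exact: can_inj (@rev_rowK n).
by move=> x y; rewrite -rev_rowD gen_rev.
Qed.

(** Conjugation by the reversal carries results about the first coordinate to the last one. *)
Definition rev_conj (f : 'rV['F_2]_n -> 'rV['F_2]_n) x :=
  rev_row (f (rev_row x)).

Lemma gen_aut_rev_conj f : gen_aut f -> gen_aut (rev_conj f).
Proof.
move=> f_aut; have := gen_aut_comp gen_aut_rev (gen_aut_comp f_aut gen_aut_rev).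
exact.
Qed.

Lemma id_at_rev_conj f x : id_at f x -> id_at (rev_conj f) (rev_row x).
Proof.
move=> idx i i_in; rewrite /rev_conj rev_rowD rev_rowK rev_u; last lia.
rewrite idx; last lia.
by rewrite rev_rowD rev_u; [congr (_ + u _); lia | lia].
Qed.

Lemma id_at_last f x : gen_aut f -> id_at f x -> exists e : bool,
  f (x + u n.-1) = f x + (u n.-1 + u n.-2 *+ e).
Proof.
move=> f_aut idx.
have [e] := id_at_first n_ge4 (gen_aut_rev_conj f_aut) (id_at_rev_conj idx).
rewrite /rev_conj rev_rowD !rev_rowK rev_u; last lia.
move/(congr1 (@rev_row n)); rewrite !(rev_rowD, rev_rowK) rev_u; last lia.
have -> : (n - 1)%N = n.-1 by lia.
move=> ->; exists e; congr (_ + (_ + _)).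
case: e; rewrite ?mulr0n ?rev_row0 // !mulr1n rev_u; last lia.
by congr u; lia.
Qed.

Lemma id_at_all f : gen_aut f -> id_at f 0 -> forall x, id_at f x.
Proof.
move=> f_aut id0; apply: vec_ind => // x i i_n idx.
have [->|i_gt0] := posnP i; first exact: id_at_addu0.
have [i_in|i_out] := boolP (0 < i < n.-1)%N; first exact: id_at_addu_inner.
have -> : i = (n - 1)%N by lia.
have := id_at_addu0 n_ge4 (gen_aut_rev_conj f_aut) (id_at_rev_conj idx).
move/id_at_rev_conj; rewrite rev_rowD rev_rowK rev_u; last lia.
by move=> H j j_in; have := H j j_in; rewrite /rev_conj !rev_rowK.
Qed.

(** A product of two optional transvections, one at each end of the chain. *)
Definition shear (d e : bool) x :=
  x + u 1 *+ (d && bit x 0) + u n.-2 *+ (e && bit x n.-1).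

Lemma bit_shear d e x k : bit (shear d e x) k =
  bit x k (+) [&& d, bit x 0 & k == 1%N] (+) [&& e, bit x n.-1 & k == n.-2].
Proof.
have [nk|kn] := leqP n k; last by rewrite !bitD !bitMn !bit_u kn -!andbA.
have [-> ->] : (k == 1)%N = false /\ (k == n.-2)%N = false by lia.
by rewrite !(bit_ge _ nk) !andbF.
Qed.

Lemma shearD d e x y : shear d e (x + y) = shear d e x + shear d e y.
Proof.
apply: bitP => k kn; rewrite !(bitD, bit_shear).
case: d e (k == 1%N) (k == n.-2) => [] [] [] [] //=; rewrite ?andbF ?andbT /=;
  by do ?case: (bit _ _).
Qed.

Lemma shear_u d e i : (0 < i < n.-1)%N -> shear d e (u i) = u i.
Proof.
by move=> i_in; apply: bitP => k kn; rewrite bit_shear !bit_u; lia.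
Qed.

Lemma shear_u0 d e : shear d e (u 0) = u 0 + u 1 *+ d.
Proof. by apply: bitP => k kn; rewrite bit_shear bitD bitMn !bit_u; lia. Qed.

Lemma shear_last d e : shear d e (u n.-1) = u n.-1 + u n.-2 *+ e.
Proof. by apply: bitP => k kn; rewrite bit_shear bitD bitMn !bit_u; lia. Qed.

Lemma shear_id : shear false false =1 id.
Proof. by move=> x; rewrite /shear !mulr0n !addr0. Qed.

Lemma shearK d e : involutive (shear d e).
Proof.
move=> x; apply: bitP => k kn; rewrite !bit_shear.
have -> : (0 == 1)%N = false by [].
have -> : (0 == n.-2)%N = false by lia.
have -> : (n.-1 == 1)%N = false by lia.
have -> : (n.-1 == n.-2)%N = false by lia.
rewrite !andbF /= !addbF.
by case: [&& d, _ & _]; case: [&& e, _ & _]; case: (bit x k).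
Qed.

(** With both end bits set, [d] and [e] flip bits 1 and [n - 2], which are different positions. *)
Lemma shear_fix d e x : bit x 0 -> bit x n.-1 -> shear d e x = x ->
  d = false /\ e = false.
Proof.
move=> x0 xl fix_x.
have [n2 n2'] : (1 == n.-2)%N = false /\ (n.-2 == 1)%N = false by lia.
split.
  have := bit_eq 1 fix_x; rewrite bit_shear x0 n2 eqxx !andbF addbF andbT.
  by case: (d) (bit x 1) => [] [].
have := bit_eq n.-2 fix_x; rewrite bit_shear xl n2' eqxx !andbF addbF andbT.
by case: (e) (bit x n.-2) => [] [].
Qed.

(** A shear can only swap [u 0] with [u 0 + u 1] and [u n.-1] with [u n.-2 + u n.-1]; it fixes every
    other generator. *)
Lemma gen_shear d e x : gen (shear d e x) = gen x.
Proof.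
suff imp y : gen y -> gen (shear d e y).
  by apply/idP/idP => /imp //; rewrite shearK.
have n1E : n.-1 = n.-2.+1 by lia.
case/genP=> -[i i_n ->]; rewrite ?shearD.
  have [->|i_gt0] := posnP i.
    by rewrite shear_u0; case: d; rewrite ?addr0 ?gen_u ?gen_uuS //; lia.
  have [->|i_ne] := eqVneq i n.-1; last by rewrite shear_u ?gen_u //; lia.
  rewrite shear_last n1E; case: e; rewrite ?addr0 ?gen_u ?gen_uSu //; lia.
have [->|i_gt0] := posnP i.
  rewrite shear_u0 shear_u; last lia.
  case: d; rewrite ?addr0 ?gen_uuS //; last lia.
  by rewrite -addrA addxx addr0 gen_u //; lia.
have [->|i_ne] := eqVneq i n.-2; last by rewrite !shear_u ?gen_uuS //; lia.
rewrite shear_u -?n1E; last lia.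
rewrite shear_last n1E addrCA.
case: e; rewrite ?addxx ?addr0 ?gen_u ?gen_uSu //; lia.
Qed.

Lemma gen_aut_shear d e : gen_aut (shear d e).
Proof.
split; first exact: can_inj (@shearK d e).
by move=> x y; rewrite -shearD gen_shear.
Qed.

(** The choices [d] and [e] at the two ends might depend on the vertex. Once they are shown
    constant, [f] and the shear agree at 0 and change alike along every unit vector. *)
Lemma id_at_shear f : gen_aut f -> f 0 = 0 -> id_at f 0 ->
  exists d e, f =1 shear d e.
Proof.
move=> f_aut f0 id0; have idf := id_at_all f_aut id0.
have [d fd] := id_at_first n_ge4 f_aut id0.
have [e fe] := id_at_last f_aut id0.
have first_const x : f (x + u 0) = f x + f (0 + u 0).
  elim/vec_ind: x => [|x i i_n IH]; first by rewrite f0 !add0r.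
  have [->|i_gt0] := posnP i.
    by rewrite -addrA addxx addr0 IH -addrA addxx addr0.
  have [i_in|i_out] := boolP (0 < i < n.-1)%N.
    by rewrite addrAC !(idf _ _ i_in) IH addrAC.
  have -> : i = n.-1 by lia.
  (* The choices [e1] and [e2] affect only coordinate [n - 2], so coordinate 1 of the 4-cycle in the
     two end directions gives [d' = d]. *)
  have [d' Ed'] := id_at_first n_ge4 f_aut (idf (x + u n.-1)).
  have [e1 Ee1] := id_at_last f_aut (idf x).
  have [e2 Ee2] := id_at_last f_aut (idf (x + u 0)).
  have -> : f (0 + u 0) = u 0 + u 1 *+ d by rewrite fd f0 add0r.
  rewrite Ed'; suff -> : d' = d by [].
  have := bit_eq 1%N Ed'; rewrite addrAC Ee2 IH Ee1 fd f0.
  rewrite !(bitD, bitMn, bit0) !bit_u; case: (bit (f x) 1); lia.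
have last_const x : f (x + u n.-1) = f x + f (0 + u n.-1).
  elim/vec_ind: x => [|x i i_n IH]; first by rewrite f0 !add0r.
  have [->|i_gt0] := posnP i.
    by rewrite addrAC (first_const (x + _)) (first_const x) IH addrAC.
  have [i_in|i_out] := boolP (0 < i < n.-1)%N.
    by rewrite addrAC !(idf _ _ i_in) IH addrAC.
  have -> : i = n.-1 by lia.
  by rewrite -addrA addxx addr0 IH -addrA addxx addr0.
exists d, e; elim/vec_ind => [|x i i_n IH].
  by rewrite f0; apply: bitP => k kn; rewrite bit_shear !bit0 !andbF.
rewrite shearD -IH.
have [->|i_gt0] := posnP i; first by rewrite first_const fd f0 add0r shear_u0.
have [i_in|i_out] := boolP (0 < i < n.-1)%N; first by rewrite idf // shear_u.
have -> : i = n.-1 by lia.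
by rewrite last_const fe f0 add0r shear_last.
Qed.

(** If [f] reverses the chain at 0, composing it with [rev_row] reduces to [id_at_shear]. *)
Lemma gen_aut_shear_or_rev f : gen_aut f -> f 0 = 0 ->
  exists d e, f =1 shear d e \/ f =1 @rev_row n \o shear d e.
Proof.
move=> f_aut f0; case: (gen_aut_id_or_rev n_ge4 f_aut 0) => [id0|rev0].
  by have [d [e fE]] := id_at_shear f_aut f0 id0; exists d, e; left.
have [|||d [e fE]] := @id_at_shear (@rev_row n \o f).
- exact: gen_aut_comp gen_aut_rev f_aut.
- by rewrite /= f0 rev_row0.
- move=> i i_in /=; rewrite rev0 // rev_rowD rev_u; last lia.
  by congr (_ + u _); lia.
by exists d, e; right=> x; rewrite /= -fE /= rev_rowK.
Qed.

End Automorphisms.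

(** * Determining numbers of the Cayley graph for [n >= 4] *)

Definition BQ n : rel 'rV['F_2]_n := fun x y => gen (x + y).

Section LargeDimension.

Variable n : nat.
Hypothesis n_ge4 : (3 < n)%N.

Local Notation u := (unit_row n).

(** Translations are automorphisms; conjugating [f] by the one that moves [x] to 0 gives an
    automorphism fixing [S] pointwise. *)
Lemma determining_aut (S : {set 'rV['F_2]_n}) f x : determining (@BQ n) S ->
  gen_aut f -> (forall y, y \in S -> f (y + x) = y + x) -> f =1 id.
Proof.
move=> /determiningP detS [f_inj fE] f_S y.
have fx : (fun z => f (z + x) + x) =1 id.
  apply: detS => [z t /addIr/f_inj/addIr//|z t|z /f_S->].
    by rewrite /BQ addrACA addxx addr0 fE addrACA addxx addr0.
  by rewrite -addrA addxx addr0.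
have := fx (y + x); rewrite -addrA addxx addr0.
by move/addIr.
Qed.

Lemma determining_gt1 (S : {set 'rV['F_2]_n}) :
  determining (@BQ n) S -> (1 < #|S|)%N.
Proof.
move=> detS; rewrite ltnNge; apply/negP => /card_le1_eqP S1.
have [x Sx] : exists x, forall y, y \in S -> y = x.
  have [->|[x xS]] := set_0Vmem S; first by exists 0 => y; rewrite inE.
  by exists x => y yS; apply: S1.
have := determining_aut (f := shear true false) (x := x) detS.
move=> /(_ (gen_aut_shear n_ge4 _ _)) sh_id.
have /sh_id/(_ (u 0)) : forall y, y \in S -> shear true false (y + x) = y + x.
  move=> y /Sx->; rewrite addxx; apply: bitP => k kn.
  by rewrite bit_shear // !bit0 !andbF.
rewrite shear_u0 //= => /(bit_eq 1); rewrite bitD !bit_u; lia.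
Qed.

(** Translating one of two vertices to 0 leaves a single vector [v], and a nontrivial automorphism
    fixing 0 and [v] is exhibited: a shear if an end bit of [v] vanishes, a sheared reversal
    otherwise. *)
Lemma determining_gt2 (S : {set 'rV['F_2]_n}) : (n < 6)%N ->
  determining (@BQ n) S -> (2 < #|S|)%N.
Proof.
move=> n_lt6 detS; rewrite ltn_neqAle determining_gt1 // andbT eq_sym.
apply/negP => /cards2P[x [y [_ SE]]].
have fixS f : gen_aut f -> f 0 = 0 -> f (y + x) = y + x -> f =1 id.
  move=> f_aut f0 fyx; apply: (determining_aut (x := x) detS f_aut) => z.
  by rewrite SE !inE => /orP[] /eqP-> //; rewrite addxx.
move: {SE detS} (y + x) fixS => v fixS.
have sh0 d e : shear d e 0 = 0 :> 'rV['F_2]_n.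
  by apply: bitP => k kn; rewrite bit_shear // !bit0 !andbF.
case v0: (bit v 0); last first.
  have := fixS _ (gen_aut_shear n_ge4 true false) (sh0 _ _).
  have -> : shear true false v = v by rewrite /shear v0 !addr0.
  move=> /(_ erefl)/(_ (u 0)); rewrite shear_u0 //= => /(bit_eq 1).
  by rewrite bitD !bit_u; lia.
case vl: (bit v n.-1); last first.
  have := fixS _ (gen_aut_shear n_ge4 false true) (sh0 _ _).
  have -> : shear false true v = v by rewrite /shear vl !addr0.
  move=> /(_ erefl)/(_ (u n.-1)); rewrite shear_last //= => /(bit_eq n.-2).
  by rewrite bitD !bit_u; lia.
(* For [n] equal to 4 or 5, only positions 1 and [n - 2] can spoil the symmetry of [v]. If they
   differ, flipping both exchanges their values, and the reversal restores [v]. *)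
pose d := bit v 1 (+) bit v n.-2.
have := fixS _ (gen_aut_comp (gen_aut_rev n) (gen_aut_shear n_ge4 d d)).
rewrite /= sh0 rev_row0 => /(_ erefl).
have -> : rev_row (shear d d v) = v.
  apply: bitP => k kn; rewrite bit_rev bit_shear // kn v0 vl /= {}/d.
  have [n4|n5] : n = 4 \/ n = 5 by lia.
    subst n; move: k kn v0 vl => [|[|[|[|]]]] //= _;
      by do 4?[case: (bit _ _) => //=].
  subst n; move: k kn v0 vl => [|[|[|[|[|]]]]] //= _;
    by do 5?[case: (bit _ _) => //=].
move=> /(_ erefl)/(_ (u 0)) /= /(bit_eq 0%N).
rewrite bit_rev bit_shear // !bit_u; lia.
Qed.

Lemma det_number_BQ_4_5 : (n < 6)%N -> det_number (@BQ n) = 3%N.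
Proof.
move=> n_lt6.
(* Fixing [u 0 + u n.-1] excludes the nontrivial shears, and [u 1] excludes the reversals, which
   send it to [u n.-2]. *)
apply: (@det_number_eq _ _ _ [set 0; u 0 + u n.-1; u 1]); last first.
- by move=> S; apply: determining_gt2.
- rewrite (leq_trans (leq_card_setU _ _)) // cards1 addn1 ltnS cards2.
  by case: eqP.
apply/determiningP => f f_inj f_e fS.
have f0 : f 0 = 0 by rewrite fS // !inE eqxx.
have f1 : f (u 1) = u 1 by rewrite fS // !inE eqxx !orbT.
have fv : f (u 0 + u n.-1) = u 0 + u n.-1 by rewrite fS // !inE eqxx !orbT.
have [d [e [] fE]] := gen_aut_shear_or_rev n_ge4 (conj f_inj f_e) f0.
  rewrite fE in fv; have [||dF eF] := shear_fix n_ge4 _ _ fv;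
    last by move=> x; rewrite fE dF eF shear_id.
  - by rewrite !bitD !bit_u; lia.
  by rewrite !bitD !bit_u; lia.
move/(bit_eq 1): f1; rewrite fE /= shear_u //; last lia.
rewrite rev_u; last lia.
rewrite !bit_u; lia.
Qed.

Lemma det_number_BQ_ge6 : (5 < n)%N -> det_number (@BQ n) = 2%N.
Proof.
(* The end bits exclude the nontrivial shears. Bit 2 excludes the reversals: its mirror position
   [n - 3] is a different one, is clear in [v], and is untouched by shears. *)
move=> n_gt5; pose v := u 0 + u 2 + u n.-1.
apply: (@det_number_eq _ _ _ [set 0; v]); last first.
- exact: determining_gt1.
- by rewrite cards2; case: eqP.
apply/determiningP => f f_inj f_e fS.
have f0 : f 0 = 0 by rewrite fS // !inE eqxx.
have fv : f v = v by rewrite fS // !inE eqxx !orbT.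
have [d [e [] fE]] := gen_aut_shear_or_rev n_ge4 (conj f_inj f_e) f0.
  rewrite fE in fv; have [||dF eF] := shear_fix n_ge4 _ _ fv;
    last by move=> x; rewrite fE dF eF shear_id.
  - by rewrite !bitD !bit_u; lia.
  by rewrite !bitD !bit_u; lia.
move/(bit_eq 2): fv; rewrite fE /= bit_rev bit_shear //.
have -> : (n - 3 == 1)%N = false by lia.
have -> : (n - 3 == n.-2)%N = false by lia.
by rewrite !andbF !addbF !bitD !bit_u; lia.
Qed.

End LargeDimension.

(** * Dimensions at most 3 *)

Lemma card_vec n : #|{: 'rV['F_2]_n}| = (2 ^ n)%N.
Proof. by rewrite card_mx card_Fp // mul1n. Qed.

Lemma gen_le2 n (v : 'rV['F_2]_n) : (n <= 2)%N -> gen v = (v != 0).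
Proof.
move=> n_le2; apply/idP/idP => [|v0].
  by apply: contraTneq => ->; rewrite genF0.
have vE k : bit v k =
    (k < n)%N && (((k == 0) && bit v 0) || ((k == 1) && bit v 1))%N.
  by case: k => [|[|k]]; rewrite ?orbF; case: ltnP => [|/(bit_ge v)->] //; lia.
apply/genP; case v0E: (bit v 0); case v1E: (bit v 1); rewrite v0E v1E in vE.
- right; exists 0%N.
    by rewrite ltnNge; apply: contraTN v1E => /(bit_ge v)->.
  by apply: bitP => k kn; rewrite vE bitD !bit_u; lia.
- left; exists 0%N.
    by rewrite ltnNge; apply: contraTN v0E => /(bit_ge v)->.
  by apply: bitP => k kn; rewrite vE !bit_u; lia.
- left; exists 1%N.
    by rewrite ltnNge; apply: contraTN v1E => /(bit_ge v)->.
  by apply: bitP => k kn; rewrite vE !bit_u; lia.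
by case/eqP: v0; apply: bitP => k kn; rewrite vE bit0; lia.
Qed.

Lemma det_number_BQ_le2 n : (n <= 2)%N -> det_number (@BQ n) = (2 ^ n).-1.
Proof.
move=> n_le2; rewrite -card_vec; apply: (det_number_complete 0) => x y.
by rewrite /BQ gen_le2 // addx_eq0.
Qed.

Local Notation u3 := (unit_row 3).

(** Adding [u3 1] swaps [u3 0] with [u3 0 + u3 1] and [u3 2] with [u3 1 + u3 2], so [x] and
    [x + u3 1] are twins. *)
Lemma gen3_twins (v : 'rV['F_2]_3) :
  v != 0 -> v != u3 1 -> gen (v + u3 1) = gen v.
Proof.
have imp w : w != u3 1 -> gen w -> gen (w + u3 1).
  by move=> w1 /genP[] [[|[|[|//]]]] // _ wE; subst w; rewrite ?eqxx // in w1 *;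
    rewrite ?(gen_uuS, gen_uSu) // -?addrA ?addxx ?addr0 ?gen_u //;
    rewrite addrC -addrA addxx addr0 gen_u.
move=> v0 v1; apply/idP/idP => [|]; last exact: imp.
move/imp; rewrite -addrA addxx addr0; apply.
by rewrite -[X in _ != X]add0r (inj_eq (addIr _)).
Qed.

Lemma gen3_mid (v : 'rV['F_2]_3) :
  bit v 1 -> ~~ gen v -> v = u3 0 + u3 1 + u3 2.
Proof.
move=> v1 gv.
have vE (w : 'rV['F_2]_3) :
    bit v 0 = bit w 0 -> bit w 1 -> bit v 2 = bit w 2 -> v = w.
  by move=> w0 w1 w2; apply: bitP => -[|[|[|]]] // _; rewrite v1 w1.
case v0: (bit v 0); case v2: (bit v 2).
- by apply: vE; rewrite ?v0 ?v2 !bitD !bit_u.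
- have E : v = u3 0 + u3 1 by apply: vE; rewrite ?v0 ?v2 !bitD !bit_u.
  by rewrite E gen_uuS in gv.
- have E : v = u3 1 + u3 2 by apply: vE; rewrite ?v0 ?v2 !bitD !bit_u.
  by rewrite E gen_uuS in gv.
have E : v = u3 1 by apply: vE; rewrite ?v0 ?v2 !bit_u.
by rewrite E gen_u in gv.
Qed.

Lemma det_number_BQ_3 : det_number (@BQ 3) = 4%N.
Proof.
pose t (x : 'rV['F_2]_3) := x + u3 1.
have t_inj : injective t by apply: addIr.
have bit_t x : bit (t x) 1 = ~~ bit x 1 by rewrite bitD bit_u; case: (bit x 1).
pose S := [set x : 'rV['F_2]_3 | ~~ bit x 1].
apply: (@det_number_eq _ _ _ S).
- apply/determiningP => f f_inj f_e fS y.
  have [yS|yS] := boolP (y \in S); first exact: fS.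
  have fyS : f y \notin S.
    by apply: contraNN yS => fyS; rewrite -(f_inj _ _ (fS _ fyS)).
  rewrite !inE !negbK in yS fyS.
  (* By [gen3_mid], [z] is the only non-neighbour of [y] in [S]. As [f] fixes [z], it is also the
     only one of [f y], whence [f y = y]. *)
  pose z := y + (u3 0 + u3 1 + u3 2).
  have zS : z \in S by rewrite inE !bitD !bit_u yS.
  have yz : ~~ BQ y z.
    rewrite /BQ /z addxK; apply/negP => /(gen_diam (i := 2) (j := 0)).
    by rewrite !bitD !bit_u => /(_ isT isT).
  have := gen3_mid (v := f y + z); rewrite -{2}(fS z zS) [gen _]f_e yz.
  rewrite bitD fyS; move: zS; rewrite inE => /negbTE-> /(_ isT isT) E.
  by rewrite -[LHS](addxK z) [z + f y]addrC E /z -addrA addxx addr0.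
- have tS : ~: S = t @: S.
    apply/setP => x; rewrite !inE negbK; apply/idP/imsetP => [x1|[y]].
      by exists (t x); rewrite ?inE ?bit_t ?x1 // /t -addrA addxx addr0.
    by rewrite inE => y1 ->; rewrite bit_t.
  have := cardsC S; rewrite card_vec tS card_imset //; lia.
move=> S' detS'.
(* [S'] meets each pair of twins, so [S'] and its translate cover all 8 vertices. *)
suff /subset_leq_card : [set: 'rV['F_2]_3] \subset S' :|: t @: S'.
  rewrite cardsT card_vec => /leq_trans/(_ (leq_card_setU _ _)).
  by rewrite card_imset // addnn (leq_double 4).
apply/subsetP => x _; rewrite inE.
have := @determining_twins _ _ S' x (t x) _ _ _ _ detS'.
have tK : t (t x) = x by rewrite /t -addrA addxx addr0.
move=> H; have /orP[->//|tx] : (x \in S') || (t x \in S').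
  apply: H.
  - by move=> y z; rewrite /BQ addrC.
  - by move=> y; rewrite /BQ addxx genF0.
  - by apply/eqP => /(bit_eq 1); rewrite bit_t; case: (bit x 1).
  move=> z zx ztx; rewrite /BQ /t addrA gen3_twins // ?addx_eq0 //.
  by apply: contraNneq ztx => E; rewrite /t -E addrCA addxx addr0.
by rewrite -{2}tK imset_f ?orbT.
Qed.

(** * The change of basis from [AQ] to the Cayley graph *)

Section Isomorphism.

Variable n : nat.
Local Notation u := (unit_row n).

(* With [s_i] the indicator of the positions [>= i], this gives the coordinates
   of [a] in the basis [s_0, ..., s_(n-1)]. *)
Definition suffix_coord (a : 'rV['F_2]_n) : 'rV['F_2]_n :=
  row_of n (fun k => bit a k (+) ((0 < k)%N && bit a k.-1)).

Lemma suffix_coordD a b :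
  suffix_coord (a + b) = suffix_coord a + suffix_coord b.
Proof.
apply: bitP => k kn; rewrite !(bitD, bit_row) kn /=.
by case: (0 < k)%N => /=; do ?case: (bit _ _).
Qed.

Lemma suffix_coord_inj : injective suffix_coord.
Proof.
move=> a b ab; apply: bitP; elim=> [|k IH] kn.
  by move/(bit_eq 0): ab; rewrite !bit_row kn /= !addbF.
move/(bit_eq k.+1): ab; rewrite !bit_row kn /= IH ?(ltnW kn) //.
exact: addIb.
Qed.

(** The standard vector [e_i] is [s_i + s_(i+1)], except that the last one equals [s_(n-1)]. *)
Lemma suffix_coord_u i : (i < n)%N ->
  suffix_coord (u i) = if (i.+1 < n)%N then u i + u i.+1 else u i.
Proof.
move=> i_n; apply: bitP => k kn; rewrite bit_row.
by case: ifP => i1_n; rewrite ?bitD !bit_u; lia.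
Qed.

Lemma suffix_coord_suffix l : suffix_coord (row_of n (leq l)) = u l.
Proof. by apply: bitP => k kn; rewrite bit_row bit_u !bit_row; lia. Qed.

Lemma AQ_suffix_coord a b : AQ a b = BQ (suffix_coord a) (suffix_coord b).
Proof.
rewrite /BQ -suffix_coordD.
have neqE i : (a ord0 i != b ord0 i) = bit (a + b) i.
  rewrite bit_ord mxE; move: (a _ _) (b _ _) => x y.
  by case: x y => [[|[|x]] hx] [[|[|y]] hy].
have eqE i : (a ord0 i == b ord0 i) = ~~ bit (a + b) i by rewrite -neqE negbK.
apply/orP/genP => [[/cards1P[i /setP iE]|/existsP[l]]|].
- have abE : a + b = u i.
    apply: bitP => k kn; have := iE (Ordinal kn); rewrite !inE neqE /= => ->.
    by rewrite bit_u kn.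
  rewrite abE suffix_coord_u //; case: ifP => i1; first by right; exists i.
  by left; exists i.
- case/andP=> /forallP lt_l /forallP ge_l.
  have abE : a + b = row_of n (leq l).
    apply: bitP => k kn; rewrite bit_row kn /=.
    have := lt_l (Ordinal kn); have := ge_l (Ordinal kn).
    by rewrite neqE eqE /=; case: leqP => //= _ _ /negbTE.
  left; exists l; rewrite ?abE ?suffix_coord_suffix //.
  by have := ltn_ord l; lia.
have card1 i : (i < n)%N -> a + b = u i ->
    #|[set j | a ord0 j != b ord0 j]| == 1%N.
  move=> i_n abE; apply/cards1P; exists (Ordinal i_n); apply/setP => j.
  by rewrite !inE neqE abE bit_u ltn_ord.
case=> -[i i_n abE].
  (* The generator [u n.-1] comes from flipping the last position alone; every other [u i] comes
     from a suffix flip within the bound [i <= n - 2]. *)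
  have [i1_n|i1_n] := ltnP i.+1 n; last first.
    left; apply: (card1 i) => //; apply: suffix_coord_inj.
    by rewrite abE suffix_coord_u // ltnNge i1_n.
  right; apply/existsP; have i_n1 : (i < n.-1)%N by lia.
  exists (Ordinal i_n1).
  have E : a + b = row_of n (leq i).
    by apply: suffix_coord_inj; rewrite abE suffix_coord_suffix.
  apply/andP; split; apply/forallP => j; apply/implyP;
    by rewrite ?neqE ?eqE E bit_row ltn_ord /= -?ltnNge.
left; apply: (card1 i); first exact: ltnW.
by apply: suffix_coord_inj; rewrite abE suffix_coord_u ?i_n // ltnW.
Qed.

Lemma det_number_AQ : det_number (@AQ n) = det_number (@BQ n).
Proof.
apply: det_number_iso AQ_suffix_coord; exact: injF_bij suffix_coord_inj.
Qed.

End Isomorphism.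

Local Close Scope ring_scope.

Theorem theorem7p3 (n : nat) (n_gt0 : 0 < n) :
  det_number (@AQ n) =
    if n == 1 then 1
    else if n == 2 then 3
    else if n == 3 then 4
    else if (n == 4) || (n == 5) then 3
    else 2.
Proof.
rewrite det_number_AQ.
case: n n_gt0 => [|[|[|[|[|[|n]]]]]] // _.
(* For [n] equal to 1 and 2, [(2 ^ n).-1] computes to 1 and 3. *)
- exact: det_number_BQ_le2.
- exact: det_number_BQ_le2.
- exact: det_number_BQ_3.
- exact: det_number_BQ_4_5.
- exact: det_number_BQ_4_5.
exact: det_number_BQ_ge6.
Qed.
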